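(* Let $0\le q<1$ and $\mathsf a,\mathsf b\ge 0$ with $\mathsf a\mathsf b\notin\{1,1/q,1/q^2,\dots\}$ (for $q=0$: $\mathsf a\mathsf b\ne1$). Then the two-layer weight function $\widetilde Q$ with parameters $\mathsf a,\mathsf b,q$ satisfies the following boundary and bulk equations: $$\widetilde Q\begin{pmatrix}0&\boldsymbol\tau\\ \xi'&\boldsymbol\xi\end{pmatrix}-q\,\mathsf a\,\widetilde Q\begin{pmatrix}1&\boldsymbol\tau\\ \xi'&\boldsymbol\xi\end{pmatrix}=\mathsf a^{\xi'}\,\widetilde Q\begin{pmatrix}\boldsymbol\tau\\ \boldsymbol\xi\end{pmatrix},$$ $$\widetilde Q\begin{pmatrix}\boldsymbol\tau&1\\ \boldsymbol\xi&\xi'\end{pmatrix}-q\,\mathsf b\,\widetilde Q\begin{pmatrix}\boldsymbol\tau&0\\ \boldsymbol\xi&\xi'\end{pmatrix}=\mathsf b^{1-\xi'}\,\widetilde Q\begin{pmatrix}\boldsymbol\tau\\ \boldsymbol\xi\end{pmatrix},$$ $$\widetilde Q\begin{pmatrix}\boldsymbol\tau_1&1&0&\boldsymbol\tau_2\\ \boldsymbol\xi_1&\xi'&\xi''&\boldsymbol\xi_2\end{pmatrix}-q\,\widetilde Q\begin{pmatrix}\boldsymbol\tau_1&0&1&\boldsymbol\tau_2\\ \boldsymbol\xi_1&\xi'&\xi''&\boldsymbol\xi_2\end{pmatrix}=\widetilde Q\begin{pmatrix}\boldsymbol\tau_1&1-\xi''&\boldsymbol\tau_2\\ \boldsymbol\xi_1&\xi'&\boldsymbol\xi_2\end{pmatrix},$$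 for all $\xi',\xi''\in\{0,1\}$, all $L=0,1,2,\dots$, all $\boldsymbol\tau,\boldsymbol\xi\in\Omega_L$, and all $(\boldsymbol\tau_1,\boldsymbol\tau_2),(\boldsymbol\xi_1,\boldsymbol\xi_2)\in\Omega_L$ (with $\boldsymbol\tau_1,\boldsymbol\xi_1$ of the same length and $\boldsymbol\tau_2,\boldsymbol\xi_2$ of the same length, possibly empty).
   Context: **Sequences.** $\Omega_L=\{0,1\}^L$, with $\Omega_0$ consisting of the empty sequence $\emptyset$. Functions $Q$ and $\widetilde Q$ are defined on $\bigcup_{L\ge0}\Omega_L\times\Omega_L$, the parameter $L$ being determined by the common length of the two arguments. Two-row arrays such as $\begin{pmatrix}\boldsymbol\tau_1&\boldsymbol\tau_2&\boldsymbol\tau_3\\ \boldsymbol\xi_1&\boldsymbol\xi_2&\boldsymbol\xi_3\end{pmatrix}$ denote the pair consisting of the concatenation $(\boldsymbol\tau_1,\boldsymbol\tau_2,\boldsymbol\tau_3)$ of the top row and the concatenation $(\boldsymbol\xi_1,\boldsymbol\xi_2,\boldsymbol\xi_3)$ of the bottom row. **$q$-notation.** $(z;q)_n=\prod_{k=0}^{n-1}(1-zq^k)$ and $[n]_q=1+q+\dots+q^{n-1}$ (with $q^0=1$ also when $q=0$, and $0^0=1$ throughout). The Jackson derivative is $(\mathcal D_q f)(z)=\frac{f(z)-f(qz)}{z(1-q)}$ for $z\neq0$. It is applied here to rational functions that are regular at $0$; the result is again such a function, and for $q=0$ the term $f(qz)$ is the value $f(0)$ of the rational function at $0$. $\mathcal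 D_q z$ denotes the operator $f\mapsto \mathcal D_q[zf(z)]$. **Compositions and polynomials $w_{\boldsymbol\sigma}$.** A composition $\boldsymbol\sigma=(\sigma_0,\dots,\sigma_r)$ of $L+1$ into $r+1$ parts is a sequence of strictly positive integers with $\sigma_0+\dots+\sigma_r=L+1$. For such $\boldsymbol\sigma$ and $z\ne 0,1,1/q,1/q^2,\dots$ define $$w_{\boldsymbol\sigma}(z)=(z;q)_{L+2}\prod_{j=0}^r\Big((\mathcal D_q z)^{\sigma_j-1}\mathcal D_q\Big)\Big[\tfrac1{1-z}\Big],$$ where the factors in the operator product are ordered from $j=0$ on the left to $j=r$ on the right. This expression is a polynomial in $z$ with nonnegative coefficients, so $w_{\boldsymbol\sigma}(z)$ is defined for all real $z$ by this polynomial; for $|z|<1$ it equals $(z;q)_{L+2}\sum_{n=0}^\infty z^n\prod_{j=0}^r([n+j+1]_q)^{\sigma_j}$. **Paths.** For $(\boldsymbol\tau,\boldsymbol\xi)\in\Omega_L\times\Omega_L$ let $\boldsymbol\gamma=\gamma(\boldsymbol\tau,\boldsymbol\xi)=(\gamma_0,\dots,\gamma_L)$ with $\gamma_0=0$ and $\gamma_k=\sum_{j=1}^k(\tau_j-\xi_j)$. Let $\min(\boldsymbol\gamma)$ and $\max(\boldsymbol\gamma)$ be the minimum and the maximum of $\gamma_0,\dots,\gamma_L$, let $r=\max(\boldsymbol\gamma)-\min(\boldsymbol\gamma)$, and let $\sigma(\boldsymbol\gamma)=(\sigma_0,\dots,\sigma_r)$ be the composition of $L+1$ given by $\sigma_i=\#\{j\in\{0,\dots,L\}:\gamma_j=\min(\boldsymbol\gamma)+i\}$.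 **Weight functions.** For $\mathsf a,\mathsf b\ge0$ put $$Q\begin{pmatrix}\boldsymbol\tau\\ \boldsymbol\xi\end{pmatrix}=\frac{\mathsf b^{\gamma_L}}{(\mathsf a\mathsf b)^{\min(\boldsymbol\gamma)}}\,w_{\sigma(\boldsymbol\gamma)}(\mathsf a\mathsf b),$$ where the prefactor is understood as the monomial $\mathsf a^{-\min(\boldsymbol\gamma)}\mathsf b^{\gamma_L-\min(\boldsymbol\gamma)}$, whose exponents are nonnegative. For $\mathsf a\mathsf b\notin\{1,1/q,1/q^2,\dots\}$ and $\boldsymbol\tau,\boldsymbol\xi\in\Omega_L$, $L=0,1,\dots$, put $$\widetilde Q\begin{pmatrix}\boldsymbol\tau\\ \boldsymbol\xi\end{pmatrix}=\frac{(\mathsf a\mathsf b;q)_2}{(\mathsf a\mathsf b;q)_{L+2}}\;Q\begin{pmatrix}\boldsymbol\tau\\ \boldsymbol\xi\end{pmatrix},$$ with $\widetilde Q(\emptyset)=1$ for $L=0$. *)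

(* Defs.v *)
From mathcomp Require Import all_boot all_order all_algebra.
From mathcomp Require Import generic_quotient ring.

Set Implicit Arguments.
Unset Strict Implicit.
Unset Printing Implicit Defensive.

Import Order.TTheory GRing.Theory Num.Theory.
Local Open Scope ring_scope.

Notation "x %:F" := (@FracField.tofrac _ x) : ring_scope.

Definition qpoch (A : comNzRingType) (z q : A) (n : nat) : A :=
  \prod_(k < n) (1 - z * q ^+ k).

Section RationalFunctions.

Variable R : realFieldType.

(* The representative of a fraction picked by [repr] need not be in lowest
   terms, so the common factors are divided out: with q = 0, substituting q z
   for z in a rational function regular at 0 needs a denominator which does not
   vanish at 0. *)
Definition rnum (f : {fraction {poly R}}) : {poly R} :=
  \n_(repr f) %/ gcdp \n_(repr f) \d_(repr f).
Definition rden (f : {fraction {poly R}}) : {poly R} :=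
  \d_(repr f) %/ gcdp \n_(repr f) \d_(repr f).

(* z |-> f (q z); when q = 0 this is the constant f(0) for f regular at 0. *)
Definition qshift (q : R) (f : {fraction {poly R}}) : {fraction {poly R}} :=
  (rnum f \Po (q *: 'X))%:F / (rden f \Po (q *: 'X))%:F.

Definition jackson (q : R) (f : {fraction {poly R}}) : {fraction {poly R}} :=
  (f - qshift q f) / ((1 - q) *: 'X)%:F.

(* f |-> D_q [z f(z)] *)
Definition jacksonX (q : R) (f : {fraction {poly R}}) : {fraction {poly R}} :=
  jackson q ('X%:F * f).

(* The product over j = 0, ..., r of (D_q z)^(sigma_j - 1) D_q, with the factor
   j = 0 leftmost (hence applied last), evaluated at 1 / (1 - z). *)
Definition wops (q : R) (sigma : seq nat) : {fraction {poly R}} :=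
  foldr (fun s f => iter s.-1 (jacksonX q) (jackson q f))
        ((1 - 'X)%:F)^-1 sigma.

(* If sigma is a composition of L + 1 then L + 2 = (sumn sigma).+1 *)
Definition wfrac (q : R) (sigma : seq nat) : {fraction {poly R}} :=
  (qpoch 'X q%:P (sumn sigma).+1)%:F * wops q sigma.

(* The quotient is exact: see [wpolyE]. *)
Definition wpoly (q : R) (sigma : seq nat) : {poly R} :=
  rnum (wfrac q sigma) %/ rden (wfrac q sigma).

End RationalFunctions.

Section Paths.

Variables tau xi : seq bool.

Definition path_pt (k : nat) : int :=
  \sum_(j < k) ((nth false tau j : nat)%:Z - (nth false xi j : nat)%:Z).

(* Since path_pt 0 = 0, the default value 0 of the iterated minimum and maximum
   is one of the values of the path. *)
Definition path_min : int :=
  \big[Order.min/0]_(k < (size tau).+1) path_pt k.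
Definition path_max : int :=
  \big[Order.max/0]_(k < (size tau).+1) path_pt k.

Definition path_range : nat := `|path_max - path_min|%N.

Definition path_comp : seq nat :=
  mkseq (fun i => #|[set j : 'I_(size tau).+1 | path_pt j == path_min + i%:Z]|)
        path_range.+1.

End Paths.

Section Weights.

Variables (R : realFieldType) (q a b : R).

Definition Q (tau xi : seq bool) : R :=
  let m := path_min tau xi in
  a ^ (- m) * b ^ (path_pt tau xi (size tau) - m)
  * (wpoly q (path_comp tau xi)).[a * b].

Definition Qtilde (tau xi : seq bool) : R :=
  qpoch (a * b) q 2 / qpoch (a * b) q (size tau).+2 * Q tau xi.

End Weights.

Section WPolynomial.

Variables (R : realFieldType) (q : R).

Local Notation frac_regular n f :=
  (exists p : {poly R}, f = p%:F / (qpoch 'X q%:P n)%:F).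

Lemma numden_frac (f : {fraction {poly R}}) :
  f * (\d_(repr f))%:F = (\n_(repr f))%:F.
Proof.
rewrite -{1}[f]reprK; move: (repr f) => x.
unlock FracField.tofrac.
have := FracField.pi_mul x (Ratio \d_x 1) => /= E.
apply: (etrans (esym E)).
apply/eqmodP.
rewrite /= FracField.equivfE /FracField.mulf.
by rewrite !numden_Ratio ?mulr1 ?oner_eq0 ?denom_ratioP // mulrC.
Qed.

Lemma rden_neq0 (f : {fraction {poly R}}) : rden f != 0.
Proof.
rewrite /rden dvdp_div_eq0 ?dvdp_gcdr //; exact: denom_ratioP.
Qed.

Lemma rnum_rden (f : {fraction {poly R}}) : f = (rnum f)%:F / (rden f)%:F.
Proof.
have d0 : (\d_(repr f))%:F != 0 :> {fraction {poly R}}.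
  by rewrite tofrac_eq0 denom_ratioP.
have r0 : (rden f)%:F != 0 :> {fraction {poly R}}.
  by rewrite tofrac_eq0 rden_neq0.
have g0 : gcdp \n_(repr f) \d_(repr f) != 0.
  by rewrite gcdp_eq0 negb_and denom_ratioP orbT.
apply: (mulIf r0); rewrite divfK //.
apply: (@mulIf _ (gcdp \n_(repr f) \d_(repr f))%:F); first by rewrite tofrac_eq0.
rewrite -mulrA -!tofracM /rden /rnum !divpK ?dvdp_gcdl ?dvdp_gcdr //.
exact: numden_frac.
Qed.

Lemma coprimep_rnum_rden (f : {fraction {poly R}}) :
  coprimep (rnum f) (rden f).
Proof.
rewrite /rnum /rden coprimep_div_gcd //.
by rewrite denom_ratioP orbT.
Qed.

Lemma eq_frac (p d n e : {poly R}) : d != 0 -> e != 0 ->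
  (p%:F / d%:F == n%:F / e%:F) = (p * e == n * d).
Proof.
move=> d0 e0; have dF : d%:F != 0 by rewrite tofrac_eq0.
have eF : e%:F != 0 by rewrite tofrac_eq0.
by rewrite (GRing.eqr_div p%:F n%:F dF eF) -!tofracM tofrac_eq.
Qed.

Lemma frac_cross (p d : {poly R}) : d != 0 ->
  rnum (p%:F / d%:F) * d = p * rden (p%:F / d%:F).
Proof.
move=> d0; have := rnum_rden (p%:F / d%:F).
move: (rnum _) (rden _) (rden_neq0 (p%:F / d%:F)) => n e e0 /eqP.
by rewrite eq_frac // => /eqP.
Qed.

Lemma qshift_frac (p d : {poly R}) : d.[0] != 0 ->
  qshift q (p%:F / d%:F) = (p \Po (q *: 'X))%:F / (d \Po (q *: 'X))%:F.
Proof.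
move=> d00.
have d0 : d != 0 by apply: contraNneq d00 => ->; rewrite horner0.
have cr := frac_cross p d0; rewrite /qshift.
set f := p%:F / d%:F in cr *.
have comp0 (e : {poly R}) : e.[0] != 0 -> e \Po (q *: 'X) != 0.
  move=> e0; apply: contraNneq e0 => /(congr1 (horner^~ 0)).
  by rewrite horner_comp hornerZ hornerX mulr0 horner0 => ->.
have dv : rden f %| d.
  rewrite -(@Gauss_dvdpr _ _ (rnum f)) ?cr ?dvdp_mull //.
  by rewrite coprimep_sym coprimep_rnum_rden.
have rd0 : (rden f).[0] != 0.
  apply: contraNneq d00 => e0; case/dvdpP: dv => c ->.
  by rewrite hornerM e0 mulr0.
apply/eqP; rewrite eq_frac ?comp0 // -!comp_polyM cr.
by [].
Qed.

Lemma qpochX_at0 n : (qpoch 'X q%:P n : {poly R}).[0] = 1.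
Proof.
rewrite /qpoch horner_prod big1 // => i _.
by rewrite !(hornerE, mul0r, subr0).
Qed.

Lemma qpochX_neq0 n : qpoch 'X q%:P n != 0 :> {poly R}.
Proof.
apply/eqP => /(congr1 (horner^~ 0)).
by rewrite qpochX_at0 horner0 => /eqP; rewrite oner_eq0.
Qed.

Lemma qpochX_shift n :
  (1 - 'X) * (qpoch 'X q%:P n \Po (q *: 'X)) = qpoch 'X q%:P n.+1 :> {poly R}.
Proof.
rewrite /qpoch big_ord_recl expr0 mulr1; congr (_ * _).
rewrite rmorph_prod /=; apply: eq_bigr => i _.
rewrite comp_polyB comp_polyC comp_polyM comp_polyX -polyC_exp comp_polyC.
by rewrite /bump /= add1n exprS -mul_polyC polyC_exp mulrA ['X * _]mulrC.
Qed.

Lemma jackson_regular n f : q != 1 ->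
  frac_regular n f -> frac_regular n.+1 (jackson q f).
Proof.
move=> q1 [p ->].
set d := qpoch _ _ n; set d' := qpoch _ _ n.+1.
pose ds := d \Po (q *: 'X); pose ps := p \Po (q *: 'X).
pose u := 1 - 'X * q%:P ^+ n : {poly R}.
pose m := p * u - ps * (1 - 'X).
have d'u : d' = d * u by rewrite /d' /qpoch big_ord_recr.
have d's : d' = (1 - 'X) * ds by rewrite qpochX_shift.
have dn0 : d != 0 := qpochX_neq0 n.
have d'n0 : d' != 0 := qpochX_neq0 n.+1.
have sn0 : ds != 0 by apply: contraNneq d'n0 => e0; rewrite d's e0 mulr0.
have q1' : 1 - q != 0 by rewrite subr_eq0 eq_sym.
have Xdv : 'X %| m.
  rewrite -['X]subr0 -polyC0 dvdp_XsubCl /root /m /u /ps !hornerE.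
  by rewrite horner_comp !hornerE subrr.
exists ((1 - q)^-1 *: (m %/ 'X)).
rewrite /jackson qshift_frac ?qpochX_at0 ?oner_eq0 // -/ds -/ps -/d.
have -> : p%:F / d%:F - ps%:F / ds%:F = m%:F / d'%:F.
  rewrite -mulNr addf_div ?tofrac_eq0 //; apply/eqP.
  rewrite GRing.eqr_div ?mulf_neq0 ?tofrac_eq0 //.
  rewrite -tofracN -!tofracM -tofracD -tofracM tofrac_eq; apply/eqP.
  have -> : (p * ds + - ps * d) * d' = p * ds * (d * u) - ps * d * ((1 - 'X) * ds).
    by rewrite -d'u -d's mulrDl !mulNr.
  by rewrite /m; ring.
rewrite mulrAC; congr (_ / _).
have c0 : ((1 - q) *: 'X)%:F != 0 :> {fraction {poly R}}.
  by rewrite tofrac_eq0 scaler_eq0 negb_or q1' polyX_eq0.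
apply: (mulIf c0); rewrite divfK // -tofracM; congr (_ %:F).
by rewrite -scalerAl -scalerAr scalerA mulVf // scale1r divpK.
Qed.

Lemma jacksonX_regular n f : q != 1 ->
  frac_regular n f -> frac_regular n.+1 (jacksonX q f).
Proof.
move=> q1 [p ->]; apply: jackson_regular => //.
by exists ('X * p); rewrite mulrA tofracM.
Qed.

Lemma wops_regular sigma : q != 1 -> all (leq 1) sigma ->
  frac_regular (sumn sigma).+1 (wops q sigma).
Proof.
move=> q1; rewrite /wops; elim: sigma => [_|[|s] sigma IH] //=.
  by exists 1; rewrite tofrac1 div1r /qpoch big_ord1 expr0 mulr1.
move=> /IH /(jackson_regular q1) reg.
rewrite -addSn addnC -addSnnS addnC.
elim: s => [|s IHs] //=.
exact: jacksonX_regular.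
Qed.

Lemma wpolyE sigma : q != 1 -> all (leq 1) sigma ->
  (wpoly q sigma)%:F = wfrac q sigma.
Proof.
move=> q1 /(wops_regular q1) [p E].
have {}E : wfrac q sigma = p%:F / 1%:F.
  by rewrite /wfrac E tofrac1 divr1 mulrC divfK // tofrac_eq0 qpochX_neq0.
rewrite /wpoly E; have := frac_cross p (oner_neq0 _).
by rewrite mulr1 => ->; rewrite mulpK ?rden_neq0 // tofrac1 divr1.
Qed.

End WPolynomial.

Lemma Qtilde_nil (R : realFieldType) (q a b : R) : q != 1 ->
  (forall k : nat, a * b * q ^+ k != 1) -> Qtilde q a b [::] [::] = 1.
Proof.
move=> q1 hab.
have pt0 k : path_pt [::] [::] k = 0.
  by rewrite /path_pt big1 // => j _; rewrite !nth_nil subrr.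
have min0 : path_min [::] [::] = 0.
  by rewrite /path_min big_ord_recl big_ord0 pt0 minxx.
have max0 : path_max [::] [::] = 0.
  by rewrite /path_max big_ord_recl big_ord0 pt0 maxxx.
have comp1 : path_comp [::] [::] = [:: 1%N].
  rewrite /path_comp /path_range max0 min0 /mkseq /=; congr [:: _].
  under eq_finset => j do rewrite pt0 eqxx.
  by rewrite cardsT card_ord.
have w1 : wpoly q [:: 1%N] = 1.
  apply/eqP; rewrite -tofrac_eq wpolyE // /wfrac /wops /=; apply/eqP.
  have d10 : (1 - 'X : {poly R}).[0] != 0 by rewrite !hornerE subr0 oner_eq0.
  have n10 : 1 - 'X != 0 :> {poly R}.
    by apply: contraNneq d10 => ->; rewrite horner0.
  have n20 : 1 - q *: 'X != 0 :> {poly R}.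
    apply/eqP => /(congr1 (horner^~ 0)); rewrite !hornerE => /eqP.
    by rewrite ?mulr0 ?subr0 oner_eq0.
  have c0 : (1 - q) *: 'X != 0 :> {poly R}.
    by rewrite scaler_eq0 negb_or subr_eq0 eq_sym q1 polyX_eq0.
  rewrite /jackson -[(1 - 'X)%:F^-1]mul1r -tofrac1 qshift_frac //.
  rewrite comp_polyB comp_polyX -polyC1 !comp_polyC polyC1 -mulNr.
  rewrite addf_div ?tofrac_eq0 // -tofracN -!tofracM -tofracD.
  have -> : 1 * (1 - q *: 'X) + - 1 * (1 - 'X) = (1 - q) *: 'X :> {poly R}.
    by rewrite scalerBl scale1r; ring.
  have -> : qpoch 'X q%:P (1 + 0).+1 = (1 - 'X) * (1 - q *: 'X) :> {poly R}.
    rewrite /qpoch !big_ord_recl big_ord0 expr0 expr1 !mulr1.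
    by rewrite -mul_polyC [q%:P * _]mulrC.
  by rewrite mulrC mulrAC divfK ?tofrac_eq0 ?mulf_neq0 // divff ?tofrac_eq0.
rewrite /Qtilde /Q /= pt0 min0 oppr0 addr0 !expr0z !mul1r comp1 w1 hornerE mulr1.
rewrite divff // /qpoch; apply/prodf_neq0 => k _.
by rewrite subr_eq0 eq_sym hab.
Qed.

(* Main.v *)
(* As formal power series in z = a b, [w_sigma(z) = (z; q)_(L + 2) sum_n z^n
   prod_j [n + j + 1]^(sigma_j)]. Grouping the vertices of the path by height
   turns Q into [(ab; q)_(L + 2) sum_h a^h b^(h + gamma_L) prod_k
   [h + gamma_k + 1]], a sum over the translates of the path: a translate that
   goes below height 0 starts below 0 or visits height -1, where the weight [0]
   vanishes. All three equations then reduce, coefficient by coefficient, to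
   [n + 1] - q [n] = 1, and the factor 1 - a b q^(L + 2) relating the two path
   lengths is absorbed by the normalization of Qtilde. Since polynomials are
   determined by their coefficients, a b < 1 is not needed. *)
Require Import Defs.
From mathcomp Require Import all_boot all_order all_algebra.
From mathcomp Require Import ring zify.

Set Implicit Arguments.
Unset Strict Implicit.
Unset Printing Implicit Defensive.

Import Order.TTheory GRing.Theory Num.Theory.
Local Open Scope ring_scope.

(** * Formal power series expansions of fractions of polynomials *)

Section PowerSeries.

Variable R : realFieldType.
Implicit Types (p d : {poly R}) (c : nat -> R) (f : {fraction {poly R}}).

(* p / d = sum_n c_n X^n as a formal power series (meaningful if d(0) != 0). *)
Definition expands p d c :=
  forall N, 'X^N %| p - d * \poly_(n < N) c n.

Definition frac_expands f c :=
  exists p d, [/\ d.[0] != 0, f = p%:F / d%:F & expands p d c].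

(** The difference is divisible by every power of ['X], in particular by one whose degree exceeds
    its own. This turns an identity between coefficients into one between polynomials, valid at
    every point. *)
Lemma expands_uniq p p' d c : expands p d c -> expands p' d c -> p = p'.
Proof.
move=> e e'; apply/eqP; rewrite -subr_eq0; apply/eqP.
have dv N : 'X^N %| p - p'.
  have -> : p - p' = p - d * \poly_(n < N) c n - (p' - d * \poly_(n < N) c n).
    by ring.
  exact: dvdp_sub.
apply/eqP; apply: contraT => n0.
have := dvdp_leq n0 (dv (size (p - p'))).
by rewrite size_polyXn ltnn.
Qed.

Lemma eq_expands p d c c' : c =1 c' -> expands p d c -> expands p d c'.
Proof.
move=> ec e N; rewrite (eq_poly c) // => n _; exact/esym.
Qed.

Lemma expandsB p p' d c c' : expands p d c -> expands p' d c' ->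
  expands (p - p') d (fun n => c n - c' n).
Proof.
move=> e e' N.
have -> : \poly_(n < N) (c n - c' n) = \poly_(n < N) c n - \poly_(n < N) c' n.
  by apply/polyP => i; rewrite coefB !coef_poly; case: ifP; rewrite ?subrr.
have -> : p - p' - d * (\poly_(n < N) c n - \poly_(n < N) c' n)
        = p - d * \poly_(n < N) c n - (p' - d * \poly_(n < N) c' n) by ring.
exact: dvdp_sub.
Qed.

Lemma polyZ_coef (x : R) N c :
  \poly_(n < N) (x * c n) = x *: \poly_(n < N) c n.
Proof.
by apply/polyP => i; rewrite coefZ !coef_poly; case: ifP; rewrite ?mulr0.
Qed.

Lemma expandsZ (x : R) p d c : expands p d c ->
  expands (x *: p) d (fun n => x * c n).
Proof.
by move=> e N; rewrite polyZ_coef -scalerAr -scalerBr -mul_polyC dvdp_mull.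
Qed.

Lemma expandsMl u p d c : expands p d c -> expands (u * p) (u * d) c.
Proof. by move=> e N; rewrite -mulrA -mulrBr dvdp_mull. Qed.

(** Since u(0) is nonzero, u is coprime to every ['X^N]. *)
Lemma expands_cancel u p d c : u.[0] != 0 ->
  expands (u * p) (u * d) c -> expands p d c.
Proof.
move=> u0 e N; have := e N; rewrite -mulrA -mulrBr Gauss_dvdpr //.
by rewrite coprimep_expl // coprimep_sym -['X]subr0 -polyC0 coprimep_XsubC.
Qed.

Lemma polyX_coef N c :
  'X * \poly_(n < N) c n.+1 = \poly_(n < N.+1) c n - (c 0)%:P.
Proof.
apply/polyP => i; rewrite coefXM coefB coefC !coef_poly.
by case: i => [|i] /=; rewrite ?subrr // subr0.
Qed.

(** Multiplication by X shifts the series, and [c 0 = 0] fills the vacated constant term. The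
    converse direction is what divides by X in the Jackson derivative. *)
Lemma expandsMX p d c : c 0 = 0 ->
  expands p d (fun n => c n.+1) <-> expands ('X * p) d c.
Proof.
move=> c0.
have E N : 'X * (p - d * \poly_(n < N) c n.+1)
         = 'X * p - d * \poly_(n < N.+1) c n.
  by rewrite mulrBr mulrCA polyX_coef c0 subr0.
have X0 : 'X != 0 :> {poly R} by rewrite polyX_eq0.
split=> e N; last first.
  by have := e N.+1; rewrite -E exprS dvdp_mul2l.
case: N => [|N]; first by rewrite expr0 dvd1p.
by rewrite -E exprS dvdp_mul2l.
Qed.

Lemma expandsMXn j p d c : (forall n, (n < j)%N -> c n = 0) ->
  expands p d (fun n => c (n + j)%N) -> expands ('X^j * p) d c.
Proof.
elim: j c => [|j IH] c c0 e.
  by rewrite expr0 mul1r; apply: eq_expands e => n; rewrite addn0.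
rewrite exprS -mulrA; apply/expandsMX; first exact: c0.
apply: IH => [n nj|]; first exact: c0.
by apply: eq_expands e => n; rewrite addnS.
Qed.

(** The substitution turns ['X^N] into [q ^+ N *: 'X^N], so the remainder stays divisible by ['X^N],
    also for q = 0. *)
Lemma expands_comp (q : R) p d c : expands p d c ->
  expands (p \Po (q *: 'X)) (d \Po (q *: 'X)) (fun n => q ^+ n * c n).
Proof.
move=> e N.
have -> : \poly_(n < N) (q ^+ n * c n) = \poly_(n < N) c n \Po (q *: 'X).
  rewrite !poly_def linear_sum /=; apply: eq_bigr => i _.
  by rewrite comp_polyZ comp_Xn_poly exprZn scalerA mulrC.
rewrite -comp_polyM -comp_polyB; case/dvdpP: (e N) => u ->.
by rewrite comp_polyM comp_Xn_poly exprZn -scalerAr -mul_polyC !dvdp_mull.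
Qed.

End PowerSeries.

(** * Action of the Jackson derivative on coefficients, and the series of [wpoly] *)

Section JacksonSeries.

Variables (R : realFieldType) (q : R).
Hypothesis q1 : q != 1.
Implicit Types (f : {fraction {poly R}}) (c : nat -> R).

(** The q-integer [k], extended by 0 to negative k so that a translated path reaching height 0 or
    below gets weight 0. *)
Definition qint (k : int) : R :=
  if k is Posz n then \sum_(i < n) q ^+ i else 0.

Lemma qint_le0 k : k <= 0 -> qint k = 0.
Proof. by case: k => [[|n]|n] //= _; rewrite big_ord0. Qed.

Lemma qint_nat n : qint n%:Z = (1 - q)^-1 * (1 - q ^+ n).
Proof.
have q1' : 1 - q != 0 by rewrite subr_eq0 eq_sym.
apply: (mulfI q1'); by rewrite mulVKf //= -[RHS]opprB subrX1 -mulNr opprB.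
Qed.

Lemma qint_succ k : 0 <= k -> qint (k + 1) - q * qint k = 1.
Proof.
case: k => // n _; rewrite -PoszD addn1 /= big_ord_recl expr0 mulr_sumr.
by under eq_bigr do rewrite exprS; rewrite addrK.
Qed.

Lemma frac_expandsX f c : c 0 = 0 ->
  frac_expands f (fun n => c n.+1) -> frac_expands ('X%:F * f) c.
Proof.
move=> c0 [p [d [d0 -> e]]]; exists ('X * p), d; split=> //.
  by rewrite mulrA tofracM.
exact/expandsMX.
Qed.

(** The n-th coefficient of f(z) - f(qz) is (1 - q^n) c_n; division by (1 - q) z turns the factor
    into [n] and lowers the degree by one. *)
Lemma frac_expands_jackson f c : frac_expands f c ->
  frac_expands (jackson q f) (fun n => qint n.+1 * c n.+1).
Proof.
move=> [p [d [d0 -> e]]].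
pose ps := p \Po (q *: 'X); pose ds := d \Po (q *: 'X).
have ds0 : ds.[0] != 0 by rewrite horner_comp !hornerE.
have nz (u : {poly R}) : u.[0] != 0 -> u != 0.
  by move=> u0; apply: contraNneq u0 => ->; rewrite horner0.
have q1' : 1 - q != 0 by rewrite subr_eq0 eq_sym.
pose m := ds * p - d * ps.
have em : expands m (d * ds) (fun n => c n - q ^+ n * c n).
  apply: expandsB; first by rewrite [d * _]mulrC; exact: expandsMl.
  exact/expandsMl/expands_comp.
(* The case N = 1 of [em]: the constant coefficient is c_0 - q^0 c_0 = 0. *)
have Xm : 'X %| m.
  by have := em 1%N; rewrite poly_def big_ord1 expr0 mul1r subrr
    scale0r mulr0 subr0 expr1.
exists ((1 - q)^-1 *: (m %/ 'X)), (d * ds); split.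
- by rewrite hornerM mulf_neq0.
- rewrite /jackson qshift_frac // -/ps -/ds.
  have -> : p%:F / d%:F - ps%:F / ds%:F = m%:F / (d * ds)%:F.
    rewrite -mulNr addf_div ?tofrac_eq0 ?nz // -tofracN -!tofracM -tofracD.
    by congr (_%:F / _); rewrite /m; ring.
  rewrite mulrAC; congr (_ / _).
  have c0 : ((1 - q) *: 'X)%:F != 0 :> {fraction {poly R}}.
    by rewrite tofrac_eq0 scaler_eq0 negb_or q1' polyX_eq0.
  apply: (mulIf c0); rewrite divfK // -tofracM; congr (_ %:F).
  by rewrite -scalerAl -scalerAr scalerA mulVf // scale1r divpK.
- have e' := expandsZ (1 - q)^-1 em.
  apply/(@expandsMX _ _ _ (fun n => qint n * c n)).
    by rewrite qint_le0 ?mul0r.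
  rewrite -scalerAr mulrC divpK //; apply: eq_expands e' => n.
  by rewrite qint_nat; ring.
Qed.

Lemma frac_expands_jacksonX f c : frac_expands f c ->
  frac_expands (jacksonX q f) (fun n => qint n.+1 * c n).
Proof.
move=> e; apply: (@frac_expands_jackson _
  (fun n => if n is n'.+1 then c n' else 0)).
exact: frac_expandsX.
Qed.

Lemma frac_expands_geometric : frac_expands (1 - 'X)%:F^-1 (fun=> 1 : R).
Proof.
exists 1, (1 - 'X); split.
- by rewrite !hornerE subr0 oner_eq0.
- by rewrite tofrac1 div1r.
- move=> N; have -> : \poly_(n < N) 1 = \sum_(n < N) 'X^n :> {poly R}.
    by rewrite poly_def; apply: eq_bigr => i _; rewrite scale1r.
  by rewrite -[1 - 'X]opprB mulNr -subrX1 opprB subKr dvdpp.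
Qed.

Lemma eq_frac_expands f c c' : c =1 c' -> frac_expands f c -> frac_expands f c'.
Proof.
move=> ec [p [d [d0 -> e]]]; exists p, d; split=> //; exact: eq_expands e.
Qed.

(** The innermost [jackson] of a factor shifts the coefficients once and gives one [n + 1]; each
    [jacksonX] gives another [n + 1] without a shift. Hence factor j, met after j shifts,
    contributes [n + j + 1] to the power sigma_j. *)
Lemma frac_expands_wops sigma : all (leq 1) sigma ->
  frac_expands (wops q sigma)
    (fun n => \prod_(j < size sigma) qint (n + j).+1 ^+ nth 0%N sigma j).
Proof.
elim: sigma => [_|[|s] sigma IH] //=.
  by apply: eq_frac_expands frac_expands_geometric => n; rewrite big_ord0.
move=> /IH /frac_expands_jackson.
rewrite -/(wops q sigma) => e.
(* The coefficients for the tail of the composition, shifted by the [jackson] of the head factor. *)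
pose c n := \prod_(j < size sigma) qint (n + j.+1).+1 ^+ nth 0%N sigma j.
suff: frac_expands (iter s (jacksonX q) (jackson q (wops q sigma)))
       (fun n => qint n.+1 ^+ s.+1 * c n).
  apply: eq_frac_expands => n; rewrite big_ord_recl addn0; congr (_ * _).
elim: s => [|s IHs] /=.
  apply: eq_frac_expands e => n; rewrite expr1; congr (_ * _).
  by apply: eq_bigr => j _; rewrite addnS.
apply: eq_frac_expands (frac_expands_jacksonX IHs) => n.
by rewrite mulrA -exprS.
Qed.

Lemma expands_wpoly sigma : all (leq 1) sigma ->
  expands (wpoly q sigma) (qpoch 'X q%:P (sumn sigma).+1)
    (fun n => \prod_(j < size sigma) qint (n + j).+1 ^+ nth 0%N sigma j).
Proof.
move=> s1; have [p [d [d0 E e]]] := frac_expands_wops s1.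
(* The denominator d of the expansion of [wops] is arbitrary; it is multiplied in and then
   cancelled, as d(0) is nonzero. *)
apply: (expands_cancel d0).
suff -> : d * wpoly q sigma = qpoch 'X q%:P (sumn sigma).+1 * p.
  by rewrite [d * _]mulrC; apply: expandsMl.
apply/eqP; rewrite -tofrac_eq !tofracM wpolyE // /wfrac E mulrCA; apply/eqP.
congr (_ * _); rewrite mulrC divfK // tofrac_eq0.
by apply: contraNneq d0 => ->; rewrite horner0.
Qed.

End JacksonSeries.

(** * Heights of the path and regrouping of its vertices by level *)

Section LatticePaths.

Implicit Types tau xi : seq bool.

Lemma path_pt0 tau xi : path_pt tau xi 0 = 0.
Proof. exact: big_ord0. Qed.

Lemma path_ptS tau xi k :
  path_pt tau xi k.+1
  = path_pt tau xi k + ((nth false tau k : nat)%:Z - (nth false xi k : nat)%:Z).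
Proof. exact: big_ord_recr. Qed.

Lemma path_pt_cons t x tau xi k :
  path_pt (t :: tau) (x :: xi) k.+1
  = (t : nat)%:Z - (x : nat)%:Z + path_pt tau xi k.
Proof. exact: big_ord_recl. Qed.

Lemma path_pt_cons_last t x tau xi :
  path_pt (t :: tau) (x :: xi) (size (t :: tau))
  = (t : nat)%:Z - (x : nat)%:Z + path_pt tau xi (size tau).
Proof. exact: path_pt_cons. Qed.

Lemma path_pt_cat tau1 xi1 tau2 xi2 k : size tau1 = size xi1 ->
  path_pt (tau1 ++ tau2) (xi1 ++ xi2) (size tau1 + k)
  = path_pt tau1 xi1 (size tau1) + path_pt tau2 xi2 k.
Proof.
elim: tau1 xi1 => [|t tau1 IH] [|x xi1] //=.
  by rewrite path_pt0 add0r.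
by move=> [/IH E]; rewrite addSn !path_pt_cons E addrA.
Qed.

Lemma path_pt_catl tau1 xi1 tau2 xi2 k :
  size tau1 = size xi1 -> (k <= size tau1)%N ->
  path_pt (tau1 ++ tau2) (xi1 ++ xi2) k = path_pt tau1 xi1 k.
Proof.
move=> s k1; apply: eq_bigr => j _.
by rewrite !nth_cat -s (leq_trans (ltn_ord j) k1).
Qed.

Lemma path_min_le tau xi k : (k <= size tau)%N ->
  path_min tau xi <= path_pt tau xi k.
Proof. by move=> k1; apply: (bigmin_le _ (Ordinal (k1 : (k < _.+1)%N))). Qed.

Lemma path_max_ge tau xi k : (k <= size tau)%N ->
  path_pt tau xi k <= path_max tau xi.
Proof. by move=> k1; apply: (le_bigmax _ _ (Ordinal (k1 : (k < _.+1)%N))). Qed.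

Lemma path_min_attained tau xi :
  exists2 k, (k <= size tau)%N & path_pt tau xi k = path_min tau xi.
Proof.
rewrite /path_min.
apply: (big_ind (fun m => exists2 k, (k <= size tau)%N & path_pt tau xi k = m)).
- by exists 0%N; rewrite ?path_pt0.
- by move=> x y hx hy; case: leP.
- by move=> i _; exists i; rewrite // -ltnS.
Qed.

Lemma path_max_attained tau xi :
  exists2 k, (k <= size tau)%N & path_pt tau xi k = path_max tau xi.
Proof.
rewrite /path_max.
apply: (big_ind (fun m => exists2 k, (k <= size tau)%N & path_pt tau xi k = m)).
- by exists 0%N; rewrite ?path_pt0.
- by move=> x y hx hy; case: leP.
- by move=> i _; exists i; rewrite // -ltnS.
Qed.

Lemma path_ivt tau xi v : path_min tau xi <= v <= path_max tau xi ->
  exists2 k, (k <= size tau)%N & path_pt tau xi k = v.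
Proof.
have [i i1 <-] := path_min_attained tau xi.
have [j j1 <-] := path_max_attained tau xi.
move=> ivj.
case: (boolP [exists k : 'I_(size tau).+1, path_pt tau xi k == v]).
  by case/existsP=> k /eqP kv; exists k; rewrite // -ltnS.
rewrite negb_exists => /forallP nv.
(* A path with steps in {-1, 0, 1} that misses v stays on one side of v. *)
have side k : (k <= size tau)%N ->
    (path_pt tau xi k < v) = (path_pt tau xi 0 < v).
  elim: k => [|k IH] // k1; rewrite -IH 1?ltnW // path_ptS.
  have := nv (Ordinal (k1 : (k.+1 < _.+1)%N)).
  have := nv (Ordinal (ltnW k1 : (k < _.+1)%N)).
  rewrite /= path_ptS.
  by case: (nth _ tau k); case: (nth _ xi k) => /=; lia.
have := side i i1; have := side j j1.
have := nv (Ordinal (i1 : (i < _.+1)%N)).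
rewrite /=; lia.
Qed.

(** The level of vertex k above the minimum. Its fibres are the sets counted by [path_comp], so sums
    and products over vertices can be regrouped by level. *)
Let idx tau xi (k : 'I_(size tau).+1) : 'I_(path_range tau xi).+1 :=
  inord `|path_pt tau xi k - path_min tau xi|%N.

Let idxE tau xi (k : 'I_(size tau).+1) (j : 'I_(path_range tau xi).+1) :
  (idx xi k == j) = (path_pt tau xi k == path_min tau xi + (j : nat)%:Z).
Proof.
have k1 : (k <= size tau)%N by rewrite -ltnS.
have := path_min_le xi k1; have := path_max_ge xi k1 => le1 le2.
rewrite -val_eqE /= inordK; first by lia.
by rewrite /path_range; lia.
Qed.

Lemma size_path_comp tau xi : size (path_comp tau xi) = (path_range tau xi).+1.
Proof. by rewrite size_mkseq. Qed.

(** By [path_ivt] no level between the minimum and the maximum is skipped. The positivity is what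
    [expands_wpoly] requires. *)
Lemma all_path_comp tau xi : all (leq 1) (path_comp tau xi).
Proof.
apply/(all_nthP 0%N) => j; rewrite size_path_comp => j1.
rewrite nth_mkseq // card_gt0; apply/set0Pn.
have [|k k1 E] := @path_ivt tau xi (path_min tau xi + j%:Z).
  have := path_min_le xi (leq0n (size tau)).
  have := path_max_ge xi (leq0n (size tau)).
  by move: j1; rewrite /path_range; lia.
by exists (Ordinal (k1 : (k < _.+1)%N)); rewrite inE E.
Qed.

Lemma sumn_path_comp tau xi : sumn (path_comp tau xi) = (size tau).+1.
Proof.
rewrite sumnE (big_nth 0%N) big_mkord size_path_comp -[RHS]card_ord -sum1_card.
rewrite (partition_big (@idx tau xi) xpredT) //=.
apply: eq_bigr => j _; rewrite nth_mkseq // -sum1dep_card.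
by apply: eq_bigl => k; rewrite idxE.
Qed.

Lemma prod_path_comp (A : comNzRingType) (g : int -> A) tau xi :
  \prod_(j < size (path_comp tau xi))
    g (path_min tau xi + (j : nat)%:Z) ^+ nth 0%N (path_comp tau xi) j
  = \prod_(k < (size tau).+1) g (path_pt tau xi k).
Proof.
rewrite size_path_comp [RHS](partition_big (@idx tau xi) xpredT) //=.
apply: eq_bigr => j _; rewrite nth_mkseq // -prodr_const.
apply: eq_big => [k|k]; rewrite inE ?idxE // => /eqP E.
by rewrite E.
Qed.

End LatticePaths.

(** * Weights of translated paths and the expansion of [Q] *)

Section PathWeights.

Variables (R : realFieldType) (q : R).
Hypothesis q1 : q != 1.
Implicit Types tau xi : seq bool.

(** The path is started at height h, which includes the summand 1 of the factors [h + gamma_k + 1]: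
    a translate survives only if it stays at height 1 or above. *)
Definition path_weight (h : int) tau xi : R :=
  \prod_(k < (size tau).+1) qint q (h + path_pt tau xi k).

Lemma path_weight_cons h t x tau xi :
  path_weight h (t :: tau) (x :: xi)
  = qint q h * path_weight (h + ((t : nat)%:Z - (x : nat)%:Z)) tau xi.
Proof.
rewrite /path_weight big_ord_recl path_pt0 addr0; congr (_ * _).
by apply: eq_bigr => k _; rewrite path_pt_cons addrA.
Qed.

Lemma path_weight_nil h : path_weight h [::] [::] = qint q h.
Proof. by rewrite /path_weight big_ord1 path_pt0 addr0. Qed.

Lemma path_weight_cat h tau1 xi1 tau2 xi2 : size tau1 = size xi1 ->
  path_weight h (tau1 ++ tau2) (xi1 ++ xi2)
  = \prod_(k < size tau1) qint q (h + path_pt tau1 xi1 k)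
    * path_weight (h + path_pt tau1 xi1 (size tau1)) tau2 xi2.
Proof.
move=> s; rewrite /path_weight size_cat -addnS big_split_ord /=.
congr (_ * _); apply: eq_bigr => k _.
  by rewrite path_pt_catl // ltnW.
by rewrite path_pt_cat // addrA.
Qed.

Lemma path_weight_eq0 h tau xi k : (k <= size tau)%N ->
  h + path_pt tau xi k <= 0 -> path_weight h tau xi = 0.
Proof.
move=> k1 hk; rewrite /path_weight (bigD1 (Ordinal (k1 : (k < _.+1)%N))) //=.
by rewrite qint_le0 // mul0r.
Qed.

(* A and B are the initial and final heights of the lowest translate retained;
   their freedom allows paths with different minima to be compared. *)
Lemma Q_expands a b tau xi (A B : nat) :
  path_min tau xi <= - A%:Z -> B%:Z = A%:Z + path_pt tau xi (size tau) ->
  exists2 p, Q q a b tau xi = a ^+ A * b ^+ B * p.[a * b]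
  & expands p (qpoch 'X q%:P (size tau).+2)
      (fun n => path_weight (n + A).+1 tau xi).
Proof.
move=> mA BA; rewrite /Q.
have := path_min_le xi (leqnn (size tau)).
have := expands_wpoly q1 (all_path_comp tau xi); rewrite sumn_path_comp.
have [k k1 km] := path_min_attained tau xi.
move: (path_min tau xi) mA km (fun g => @prod_path_comp R g tau xi).
move=> m mA km prodE.
set w := wpoly _ _ => ew ml.
(* j is the number of translates by which A exceeds the requirement set by the true minimum; the
   monomials in [Q] are a^(A + j) b^(B + j), and the surplus (ab)^j is moved into the polynomial. *)
have [j mE] : exists j : nat, m = - (A + j)%N%:Z.
  by exists `|- m - A%:Z|%N; lia.
exists ('X^j * w).
  have -> : path_pt tau xi (size tau) - m = (B + j)%N by lia.
  rewrite mE opprK -!exprnP !exprD hornerM hornerXn exprMn.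
  by ring.
apply: expandsMXn => [n nj|].
  (* For n < j the vertex k, where the minimum is attained, lies at height n + 1 - j, which is at
     most 0. *)
  by apply: (path_weight_eq0 k1); lia.
apply: eq_expands ew => n.
(* After the shift by j, level i above the minimum sits at height n + i + 1, as in
   [expands_wpoly]. *)
rewrite /path_weight -(prodE (fun x => qint q ((n + j + A).+1%:Z + x))).
apply: eq_bigr => i _; congr (qint q _ ^+ _); lia.
Qed.

End PathWeights.

(** * Boundary and bulk recurrences for [Q], and their normalization *)

Section QRecurrences.

Variables (R : realFieldType) (q a b : R).
Hypothesis q1 : q != 1.
Implicit Types tau xi : seq bool.

Lemma qpochS (A : comNzRingType) (z r : A) n :
  qpoch z r n.+1 = (1 - z * r ^+ n) * qpoch z r n.
Proof. by rewrite /qpoch big_ord_recr /= mulrC. Qed.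

(** Multiplying p0 by the last factor of the longer q-Pochhammer symbol puts both sides over the
    same denominator, where [expands_uniq] identifies them as polynomials. *)
Lemma expands_recurrence p1 p2 p0 L (c1 c2 c0 : nat -> R) z :
  expands p1 (qpoch 'X q%:P L.+1) c1 -> expands p2 (qpoch 'X q%:P L.+1) c2 ->
  expands p0 (qpoch 'X q%:P L) c0 -> (forall n, c1 n - q * c2 n = c0 n) ->
  p1.[z] - q * p2.[z] = (1 - z * q ^+ L) * p0.[z].
Proof.
move=> e1 e2 e0 c.
have e := expandsB e1 (expandsZ q e2).
have := expandsMl (1 - 'X * q%:P ^+ L) e0; rewrite -qpochS => e'.
have -> : (1 - z * q ^+ L) = (1 - 'X * q%:P ^+ L).[z].
  by rewrite -polyC_exp !hornerE.
rewrite -hornerM -(expands_uniq (eq_expands c e) e').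
by rewrite !hornerE.
Qed.

(** The translate whose lower endpoint is at height 0: A = max(0, -gamma_L) and B = max(0, gamma_L).
    The choice depends on the endpoints alone, so paths with the same endpoints can share it. *)
Lemma canonical_exponents tau xi : exists A B : nat,
  [/\ path_min tau xi <= - A%:Z, B%:Z = A%:Z + path_pt tau xi (size tau)
    & (A == 0%N) || (B == 0%N)].
Proof.
have := path_min_le xi (leq0n (size tau)); rewrite path_pt0.
have := path_min_le xi (leqnn (size tau)).
case: (path_pt _ _ _) => [B|A] ml m0.
  by exists 0%N, B; split; rewrite ?oppr0 ?add0r.
by exists A.+1, 0%N; split; rewrite -?NegzE // NegzE subrr.
Qed.

Lemma qintS n : qint q n.+1 - q * qint q n = 1.
Proof. by rewrite -addn1 PoszD qint_succ. Qed.

Lemma path_min_le_cons t x tau xi k : (k <= size tau)%N ->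
  path_min (t :: tau) (x :: xi)
  <= (t : nat)%:Z - (x : nat)%:Z + path_pt tau xi k.
Proof. by move=> k1; rewrite -path_pt_cons; apply: path_min_le. Qed.

Lemma path_min_cons_le0 t x tau xi : path_min (t :: tau) (x :: xi) <= 0.
Proof. by rewrite -(path_pt0 (t :: tau) (x :: xi)); apply: path_min_le. Qed.

Lemma path_min_le_rcons t x tau xi k : size tau = size xi ->
  (k <= size tau)%N ->
  path_min (tau ++ [:: t]) (xi ++ [:: x]) <= path_pt tau xi k.
Proof.
move=> s k1; rewrite -(path_pt_catl [:: t] [:: x] s k1); apply: path_min_le.
by rewrite size_cat addn1 ltnW.
Qed.

Lemma path_pt_rcons t x tau xi : size tau = size xi ->
  path_pt (tau ++ [:: t]) (xi ++ [:: x]) (size (tau ++ [:: t]))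
  = path_pt tau xi (size tau) + ((t : nat)%:Z - (x : nat)%:Z).
Proof.
by move=> s; rewrite size_cat path_pt_cat // path_ptS path_pt0 add0r.
Qed.

Lemma path_min_rcons_last t x tau xi : size tau = size xi ->
  path_min (tau ++ [:: t]) (xi ++ [:: x])
  <= path_pt tau xi (size tau) + ((t : nat)%:Z - (x : nat)%:Z).
Proof. by move=> s; rewrite -(path_pt_rcons t x s); apply: path_min_le. Qed.

Lemma path_weight_rcons h t x tau xi : size tau = size xi ->
  path_weight q h (tau ++ [:: t]) (xi ++ [:: x])
  = path_weight q h tau xi
    * qint q (h + path_pt tau xi (size tau) + ((t : nat)%:Z - (x : nat)%:Z)).
Proof.
move=> s; rewrite path_weight_cat // path_weight_cons path_weight_nil mulrA.
by rewrite [path_weight q h tau xi]big_ord_recr.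
Qed.

(** Both longer paths are translated so that their tails follow the path of (tau, xi) from height n
    + A + 1. They then differ only in the weight of the first vertex, and these two heights are
    consecutive. *)
Lemma Q_left tau xi x :
  Q q a b (false :: tau) (x :: xi) - q * a * Q q a b (true :: tau) (x :: xi)
  = (1 - a * b * q ^+ (size tau).+2) * (a ^+ x * Q q a b tau xi).
Proof.
have [k k1 km] := path_min_attained tau xi.
have [A [B [mA BA AB]]] := canonical_exponents tau xi.
have [p0 -> e0] := Q_expands q1 a b mA BA.
case: x.
(* The first step goes down, so this path starts one higher; [A.+1] also supplies the factor a of
   the right-hand side. *)
- have [||p1 -> e1] := @Q_expands _ _ q1 a b (false :: tau) (true :: xi) A.+1 B.
  + by have := path_min_le_cons false true xi k1 => /=; lia.
  + by rewrite path_pt_cons_last; lia.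
  have [||p2 -> e2] := @Q_expands _ _ q1 a b (true :: tau) (true :: xi) A B.
  + by have := path_min_le_cons true true xi k1 => /=; lia.
  + by rewrite path_pt_cons_last; lia.
  transitivity (a ^+ A.+1 * b ^+ B * (p1.[a * b] - q * p2.[a * b])).
    by rewrite exprS; ring.
  rewrite (expands_recurrence _ e1 e2 e0) => [|n]; first by rewrite exprS; ring.
  rewrite !path_weight_cons /= subrr addr0 addnS.
  rewrite (_ : Posz (n + A).+2 + _ = (n + A).+1) ?mulrA -?mulrBl; last by lia.
  by rewrite qintS mul1r.
- have [||p1 -> e1] := @Q_expands _ _ q1 a b (false :: tau) (false :: xi) A B.
  + by have := path_min_le_cons false false xi k1 => /=; lia.
  + by rewrite path_pt_cons_last; lia.
  have [p2 Q2 e2] : exists2 p2, a * Q q a b (true :: tau) (false :: xi)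
        = a ^+ A * b ^+ B * p2.[a * b]
      & expands p2 (qpoch 'X q%:P (size tau).+3)
          (fun n => qint q (n + A)%N * path_weight q (n + A).+1 tau xi).
    (* The first step goes up, so the start is at height n + A, calling for the exponent A - 1. If A
       = 0, the exponents 0 and B + 1 are used instead: the surplus ab becomes a factor X, whose
       missing constant term agrees with [0] = 0. *)
    case: A AB mA BA {e0 e1} => [|A] /= AB mA BA.
      have [||p -> e] :=
        @Q_expands _ _ q1 a b (true :: tau) (false :: xi) 0 B.+1.
      + exact: path_min_cons_le0.
      + by rewrite path_pt_cons_last; lia.
      exists ('X * p); first by rewrite hornerM hornerX exprS; ring.
      pose c n := qint q (n + 0)%N * path_weight q (n + 0).+1 tau xi.
      apply/(@expandsMX _ _ _ c); first by rewrite /c qint_le0 ?mul0r.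
      apply: eq_expands e => n.
      by rewrite path_weight_cons /c subr0 !addn0 -PoszD addn1.
    have [||p -> e] := @Q_expands _ _ q1 a b (true :: tau) (false :: xi) A B.
    + by have := path_min_le_cons true false xi k1 => /=; lia.
    + by rewrite path_pt_cons_last; lia.
    exists p; first by rewrite exprS; ring.
    apply: eq_expands e => n.
    by rewrite path_weight_cons subr0 addnS -PoszD addn1.
  rewrite -[q * a * _]mulrA Q2 expr0 mul1r.
  transitivity (a ^+ A * b ^+ B * (p1.[a * b] - q * p2.[a * b])); first by ring.
  rewrite (expands_recurrence _ e1 e2 e0) => [|n]; first by ring.
  by rewrite path_weight_cons subrr addr0 mulrA -mulrBl qintS mul1r.
Qed.

(** Mirror image of [Q_left]: the paths agree up to the last vertex of (tau, xi), at height n + B +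
    1, and the two added vertices have consecutive heights. *)
Lemma Q_right tau xi x : size tau = size xi ->
  Q q a b (tau ++ [:: true]) (xi ++ [:: x])
  - q * b * Q q a b (tau ++ [:: false]) (xi ++ [:: x])
  = (1 - a * b * q ^+ (size tau).+2) * (b ^+ (~~ x) * Q q a b tau xi).
Proof.
move=> s.
have sz t : size (tau ++ [:: t]) = (size tau).+1 by rewrite size_cat addn1.
have [k k1 km] := path_min_attained tau xi.
have [A [B [mA BA AB]]] := canonical_exponents tau xi.
have [p0 -> e0] := Q_expands q1 a b mA BA.
(* m is the height of the added vertex: by [BA], a path started at n + A + 1 reaches n + B + 1 just
   before it. *)
have wE (t y : bool) (n m : nat) :
    m%:Z = n%:Z + B%:Z + 1 + ((t : nat)%:Z - (y : nat)%:Z) ->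
    path_weight q (n + A).+1 (tau ++ [:: t]) (xi ++ [:: y])
    = path_weight q (n + A).+1 tau xi * qint q m.
  by move=> mE; rewrite path_weight_rcons //; congr (_ * qint q _); lia.
case: x.
- have [||p1 -> e1] :=
    @Q_expands _ _ q1 a b (tau ++ [:: true]) (xi ++ [:: true]) A B.
  + by have := path_min_le_rcons true true s k1; lia.
  + by rewrite path_pt_rcons //; lia.
  have [p2 Q2 e2] : exists2 p2,
      b * Q q a b (tau ++ [:: false]) (xi ++ [:: true])
        = a ^+ A * b ^+ B * p2.[a * b]
      & expands p2 (qpoch 'X q%:P (size tau).+3)
          (fun n => path_weight q (n + A).+1 tau xi * qint q (n + B)%N).
    (* The added step goes down to height n + B, calling for the exponent B - 1. If B = 0, the
       exponents A + 1 and 0 are used, and the surplus ab becomes a factor X matching [0] = 0. *)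
    case: B AB BA {e0 e1} wE => [|B] AB BA wE.
      have [||p -> e] :=
        @Q_expands _ _ q1 a b (tau ++ [:: false]) (xi ++ [:: true]) A.+1 0.
      + by have := path_min_rcons_last false true s; lia.
      + by rewrite path_pt_rcons //; lia.
      exists ('X * p); first by rewrite hornerM hornerX exprS; ring.
      pose c n := path_weight q (n + A).+1 tau xi * qint q (n + 0)%N.
      apply/(@expandsMX _ _ _ c); first by rewrite /c qint_le0 ?mulr0.
      rewrite sz in e; apply: eq_expands e => n.
      by rewrite addnS -addSn (wE _ _ _ (n.+1 + 0)%N) //; lia.
    have [||p -> e] :=
      @Q_expands _ _ q1 a b (tau ++ [:: false]) (xi ++ [:: true]) A B.
    + by have := path_min_le_rcons false true s k1; lia.
    + by rewrite path_pt_rcons //; lia.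
    exists p; first by rewrite [b ^+ _.+1]exprS; ring.
    rewrite sz in e; apply: eq_expands e => n.
    by rewrite (wE _ _ _ (n + B.+1)%N) //; lia.
  rewrite -[q * b * _]mulrA Q2 expr0 mul1r; rewrite sz in e1.
  transitivity (a ^+ A * b ^+ B * (p1.[a * b] - q * p2.[a * b])); first by ring.
  rewrite (expands_recurrence _ e1 e2 e0) => [|n]; first by ring.
  rewrite (wE _ _ _ (n + B).+1); last by lia.
  by rewrite mulrCA -mulrBr qintS mulr1.
- have [||p1 -> e1] :=
    @Q_expands _ _ q1 a b (tau ++ [:: true]) (xi ++ [:: false]) A B.+1.
  + by have := path_min_le_rcons true false s k1; lia.
  + by rewrite path_pt_rcons //; lia.
  have [||p2 -> e2] :=
    @Q_expands _ _ q1 a b (tau ++ [:: false]) (xi ++ [:: false]) A B.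
  + by have := path_min_le_rcons false false s k1; lia.
  + by rewrite path_pt_rcons //; lia.
  rewrite !sz in e1 e2.
  transitivity (a ^+ A * b ^+ B.+1 * (p1.[a * b] - q * p2.[a * b])).
    by rewrite [b ^+ _.+1]exprS; ring.
  rewrite (expands_recurrence _ e1 e2 e0) => [|n].
    by rewrite [b ^+ _.+1]exprS; ring.
  rewrite (wE _ _ _ (n + B).+2) 1?(wE _ _ _ (n + B).+1); try by lia.
  by rewrite mulrCA -mulrBr qintS mulr1.
Qed.

(* Where h - x is negative, qint_succ fails but qint q h = 0. *)
Lemma qint_exchange h (x : bool) :
  qint q h * (qint q (h + 1 - (x : nat)%:Z) - q * qint q (h - (x : nat)%:Z))
  = qint q h.
Proof.
have [h0|h0] := ltP 0 h; last by rewrite qint_le0 ?mul0r.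
by rewrite addrAC qint_succ ?mulr1 //; case: x; lia.
Qed.

(** The two longer paths differ in a single vertex, and deleting it from either leaves the shorter
    path. All three share their endpoints, hence the exponents A and B. *)
Lemma Q_bulk tau1 xi1 tau2 xi2 x' x'' :
  size tau1 = size xi1 -> size tau2 = size xi2 ->
  Q q a b (tau1 ++ [:: true; false] ++ tau2) (xi1 ++ [:: x'; x''] ++ xi2)
  - q * Q q a b (tau1 ++ [:: false; true] ++ tau2) (xi1 ++ [:: x'; x''] ++ xi2)
  = (1 - a * b * q ^+ (size tau1 + size tau2).+3)
    * Q q a b (tau1 ++ [:: ~~ x''] ++ tau2) (xi1 ++ [:: x'] ++ xi2).
Proof.
move=> s1 s2 /=.
set t0 := tau1 ++ _ :: tau2; set y0 := xi1 ++ x' :: xi2.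
set t1 := tau1 ++ [:: true, false & tau2].
set t2 := tau1 ++ [:: false, true & tau2].
set y := xi1 ++ [:: x', x'' & xi2].
have sz0 : size t0 = (size tau1 + size tau2).+1 by rewrite size_cat addnS.
have sz1 : size t1 = (size tau1 + size tau2).+2 by rewrite size_cat !addnS.
have sz2 : size t2 = (size tau1 + size tau2).+2 by rewrite size_cat !addnS.
have last0 : path_pt t0 y0 (size t0) = path_pt tau1 xi1 (size tau1)
    + ((~~ x'' : nat)%:Z - (x' : nat)%:Z + path_pt tau2 xi2 (size tau2)).
  by rewrite size_cat path_pt_cat // path_pt_cons_last.
have last1 : path_pt t1 y (size t1) = path_pt t0 y0 (size t0).
  rewrite last0 size_cat path_pt_cat // !path_pt_cons_last.
  by case: (x''); lia.
have last2 : path_pt t2 y (size t2) = path_pt t0 y0 (size t0).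
  rewrite last0 size_cat path_pt_cat // !path_pt_cons_last.
  by case: (x''); lia.
have [A [B [mA BA AB]]] := canonical_exponents t0 y0.
(* The minimum is at most 0 and at most the final height; as A = 0 or B = 0, one of these is -A. *)
have min_le t z : path_pt t z (size t) = path_pt t0 y0 (size t0) ->
    path_min t z <= - A%:Z.
  move=> E; have := path_min_le z (leqnn (size t)).
  by have := path_min_le z (leq0n (size t)); rewrite E path_pt0; lia.
have [p0 -> e0] := Q_expands q1 a b mA BA.
have [||p1 -> e1] := @Q_expands _ _ q1 a b t1 y A B; rewrite ?last1 ?min_le //.
have [||p2 -> e2] := @Q_expands _ _ q1 a b t2 y A B; rewrite ?last2 ?min_le //.
rewrite sz0 in e0; rewrite sz1 in e1; rewrite sz2 in e2.
transitivity (a ^+ A * b ^+ B * (p1.[a * b] - q * p2.[a * b])); first by ring.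
rewrite (expands_recurrence _ e1 e2 e0) => [|n]; first by ring.
rewrite !path_weight_cat // !path_weight_cons.
(* h is the height reached after tau1 and u the weight of the vertices before it. The differing
   vertex is at h + 1 - x' or h - x', and [qint_exchange] uses the factor [h] of its predecessor. *)
move: (_ + path_pt tau1 xi1 _) (\prod_(k < _) _) => h u.
rewrite -[in RHS](qint_exchange h x').
have -> : h + ((true : nat)%:Z - (x' : nat)%:Z) = h + 1 - (x' : nat)%:Z by lia.
have -> : h + ((false : nat)%:Z - (x' : nat)%:Z) = h - (x' : nat)%:Z by lia.
have -> : h + 1 - (x' : nat)%:Z + ((false : nat)%:Z - (x'' : nat)%:Z)
        = h + ((~~ x'' : nat)%:Z - (x' : nat)%:Z) by case: (x''); lia.
have -> : h - (x' : nat)%:Z + ((true : nat)%:Z - (x'' : nat)%:Z)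
        = h + ((~~ x'' : nat)%:Z - (x' : nat)%:Z) by case: (x''); lia.
ring.
Qed.

(** The normalizing symbols for lengths L + 1 and L differ by exactly the factor 1 - a b q^(L + 2),
    which is nonzero by assumption. The constants c and d cover all three equations. *)
Lemma Qtilde_recurrence t t2 t0 x x2 x0 (c d : R) L :
  (forall k, a * b * q ^+ k != 1) ->
  size t = L.+1 -> size t2 = L.+1 -> size t0 = L ->
  Q q a b t x - c * Q q a b t2 x2
  = (1 - a * b * q ^+ L.+2) * (d * Q q a b t0 x0) ->
  Qtilde q a b t x - c * Qtilde q a b t2 x2 = d * Qtilde q a b t0 x0.
Proof.
move=> hab s s2 s0 E; rewrite /Qtilde s s2 s0 [qpoch _ _ L.+3]qpochS.
have nz k : 1 - a * b * q ^+ k != 0 by rewrite subr_eq0 eq_sym.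
have pz : qpoch (a * b) q L.+2 != 0 by apply/prodf_neq0 => k _.
set r := qpoch _ _ 2.
transitivity (r / ((1 - a * b * q ^+ L.+2) * qpoch (a * b) q L.+2)
   * (Q q a b t x - c * Q q a b t2 x2)); first by ring.
by rewrite E; field; rewrite pz nz.
Qed.

End QRecurrences.

(* The condition on a b is written a b q^k <> 1 rather than a b <> 1 / q^k, so
   that for q = 0 it reads a b <> 1 (the inverse of 0 being 0 in MathComp). *)
Theorem theorem1p2 (R : realFieldType) (q a b : R)
    (hq0 : 0 <= q) (hq1 : q < 1) (ha : 0 <= a) (hb : 0 <= b)
    (hab : forall k : nat, a * b * q ^+ k != 1) :
  [/\ forall (L : nat) (tau xi : L.-tuple bool) (x' : bool),
        Qtilde q a b (false :: tau) (x' :: xi)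
        - q * a * Qtilde q a b (true :: tau) (x' :: xi)
        = a ^+ x' * Qtilde q a b tau xi,
      forall (L : nat) (tau xi : L.-tuple bool) (x' : bool),
        Qtilde q a b (tau ++ [:: true]) (xi ++ [:: x'])
        - q * b * Qtilde q a b (tau ++ [:: false]) (xi ++ [:: x'])
        = b ^+ (~~ x') * Qtilde q a b tau xi
    & forall (L1 L2 : nat) (tau1 xi1 : L1.-tuple bool)
             (tau2 xi2 : L2.-tuple bool) (x' x'' : bool),
        Qtilde q a b (tau1 ++ [:: true; false] ++ tau2)
                     (xi1 ++ [:: x'; x''] ++ xi2)
        - q * Qtilde q a b (tau1 ++ [:: false; true] ++ tau2)
                           (xi1 ++ [:: x'; x''] ++ xi2)
        = Qtilde q a b (tau1 ++ [:: ~~ x''] ++ tau2)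
                       (xi1 ++ [:: x'] ++ xi2)].
Proof.
have q1 : q != 1 by rewrite lt_eqF.
split.
- move=> L tau xi x'.
  apply: (@Qtilde_recurrence _ _ _ _ _ _ _ _ _ _ _ _ L) => //=;
    rewrite ?size_tuple //.
  by rewrite Q_left // size_tuple.
- move=> L tau xi x'.
  apply: (@Qtilde_recurrence _ _ _ _ _ _ _ _ _ _ _ _ L) => //;
    rewrite ?size_cat ?size_tuple ?addn1 //.
  by rewrite Q_right ?size_tuple.
- move=> L1 L2 tau1 xi1 tau2 xi2 x' x''.
  rewrite -[RHS]mul1r.
  apply: (@Qtilde_recurrence _ _ _ _ _ _ _ _ _ _ _ _ (L1 + L2).+1) => //.
  1-3: by rewrite size_cat /= !size_tuple !addnS.
  by rewrite Q_bulk ?size_tuple // mul1r.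
Qed.
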